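(* The center of the peripheral Poisson boundary is trivial: if $x\in P(P_\omega)$ satisfies $x\circ y=y\circ x$ for all $y\in P(P_\omega)$, then $x\in\mathbb{C}1$.
   Context: $H$ is a separable Hilbert space with orthonormal basis $\{e_i: i\in\Theta\}$, where $\Theta=\{1,\dots,n\}$ with $n>1$, or $\Theta=\mathbb{N}$. $\mathcal{F}(H)=\bigoplus_{n\ge 0}H^{\otimes n}$ is the full Fock space, with $H^{\otimes 0}=\mathbb{C}\Omega$, $\Omega$ a unit (vacuum) vector. For $\xi\in H$, $l_\xi$ is the left creation operator on $\mathcal{F}(H)$, $l_\xi(\eta)=\xi\otimes\eta$ (with $l_\xi\Omega=\xi$), and $l_i=l_{e_i}$. $\omega=(\omega_i)_{i\in\Theta}$ is a family of positive reals with $\sum_{i\in\Theta}\omega_i=1$, and $P_\omega:B(\mathcal{F}(H))\to B(\mathcal{F}(H))$ is the normal unital completely positive map $P_\omega(x)=\sum_{i\in\Theta}\omega_i\, l_i^*xl_i$. For $\lambda\in\mathbb{T}$ (unit circle), $E_\lambda(P_\omega)=\{x: P_\omega(x)=\lambda x\}$. The peripheral Poisson boundary $P(P_\omega)$ is the norm-closed linear span in $B(\mathcal F(H))$ of $\bigcup_{\lambda\in\mathbb{T}}E_\lambda(P_\omega)$. It is known (Bhat–Kar–Talwar) that $P(P_\omega)$ is a unital C*-algebra with the operator norm, the usual adjoint, unit $1$, and the modified Choi–Effros product $\circ$, the unique norm-continuous bilinear map on $P(P_\omega)$ such that $x\circ y=\text{SOT-}\lim_{m\to\infty}(\lambda\mu)^{-m}P_\omega^m(xy)$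 for $x\in E_\lambda(P_\omega)$, $y\in E_\mu(P_\omega)$. *)

(* Defs.v *)
From HB Require Import structures.
From mathcomp Require Import all_boot all_order all_algebra finmap.
From mathcomp Require Import sesquilinear complex.
From mathcomp Require Import all_classical all_reals all_analysis.
From mathcomp Require summability.

Set Implicit Arguments.
Unset Strict Implicit.
Unset Printing Implicit Defensive.

Import Order.TTheory GRing.Theory Num.Theory.
Import numFieldNormedType.Exports.

Local Open Scope classical_set_scope.
Local Open Scope ring_scope.
Local Open Scope complex_scope.

(* The inner product is linear in its first argument and antilinear in its
   second one. *)
HB.mixin Record isHilbert (R : realType) V & CompleteNormedModule R[i] V := {
  hdot : {dot V for Num.conj} ;
  hdotE : forall u : V, `|u| ^+ 2 = hdot u u
}.

#[short(type="hilbertType")]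
HB.structure Definition Hilbert (R : realType) :=
  {V of CompleteNormedModule R[i] V & isHilbert R V}.

Notation "''[' u , v ]" := (hdot u v) : ring_scope.

Definition lspan (K : pzRingType) (V : lmodType K) (A : set V) : set V :=
  [set v | exists2 s : seq (K * V), (forall p, p \in s -> A p.2) &
           v = \sum_(p <- s) p.1 *: p.2].

Definition is_onb (R : realType) (H : hilbertType R) (I : eqType)
    (e : I -> H) : Prop :=
  (forall i j, '[e i, e j] = (i == j)%:R) /\
  closure (lspan (range e)) = [set: H].

Section bounded_operators.
Context {R : realType} {V : normedModType R[i]}.
Implicit Types (f g : V -> V) (v : V) (c : R).

Let CD c d : (c + d)%:C = c%:C + d%:C.
Proof. exact: rmorphD. Qed.

Let CM c d : (c * d)%:C = c%:C * d%:C.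
Proof. exact: rmorphM. Qed.

Definition bounded_op : {pred V -> V} :=
  [pred f | `[< linear f /\
     exists c : R, forall v, `|f v| <= c%:C * `|v| >] ].

Lemma bounded_opP f : reflect (linear f /\
  exists c : R, forall v, `|f v| <= c%:C * `|v|) (f \in bounded_op).
Proof. by rewrite inE; exact: asboolP. Qed.

Lemma bounded_op_submod : submod_closed bounded_op.
Proof.
split=> [|a f g /bounded_opP[lf [c hc]] /bounded_opP[lg [d hd]]].
  apply/bounded_opP; split=> [a u v|]; first by rewrite scaler0 addr0.
  by exists 0 => v; rewrite normr0 mul0r.
apply/bounded_opP; split=> [b u v|].
  rewrite /= !fctE lf lg !scalerDr !scalerA [b * a]mulrC.
  by rewrite !addrA; congr (_ + _); rewrite addrAC.
have aE : `|a| = (complex.Re `|a|)%:C by rewrite RRe_real ?normr_real.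
exists (complex.Re `|a| * c + d) => v.
rewrite !fctE (le_trans (ler_normD _ _))// normrZ.
by rewrite CD CM -aE mulrDl lerD// -mulrA ler_wpM2l.
Qed.

HB.instance Definition _ :=
  GRing.isSubmodClosed.Build _ _ bounded_op bounded_op_submod.

Record bop := Bop { bop_fun :> V -> V ; bop_bounded : bop_fun \in bounded_op }.

HB.instance Definition _ := [isSub for bop_fun].
HB.instance Definition _ := [Choice of bop by <:].
HB.instance Definition _ := [SubChoice_isSubLmodule of bop by <:].

Definition opnorm (f : bop) : R :=
  inf [set c : R | 0 <= c /\ forall v, `|f v| <= c%:C * `|v|].

Let normCE v : `|v| = (complex.Re `|v|)%:C.
Proof. by rewrite RRe_real ?normr_real. Qed.

Let opnorm_has_inf (f : bop) :
  has_inf [set c : R | 0 <= c /\ forall v, `|f v| <= c%:C * `|v|].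
Proof.
have /bounded_opP[_ [c hc]] := bop_bounded f; split; last by exists 0 => c' [].
exists (Num.max 0 c); split=> [|v]; first by rewrite le_max lexx.
by rewrite (le_trans (hc v))// ler_wpM2r// lecR le_max lexx orbT.
Qed.

Lemma opnorm_ge0 (f : bop) : 0 <= opnorm f.
Proof.
by apply: lb_le_inf; [case: (opnorm_has_inf f)|move=> c []].
Qed.

Lemma opnormP (f : bop) v : `|f v| <= (opnorm f)%:C * `|v|.
Proof.
have [->|v0] := eqVneq v 0.
  have /bounded_opP[_ [c /(_ 0)]] := bop_bounded f.
  by rewrite !normr0 !mulr0.
have nv0 : 0 < complex.Re `|v| by rewrite -ltcR -normCE normr_gt0.
rewrite [in leLHS]normCE [in leRHS]normCE -CM lecR -ler_pdivrMr//.
apply: lb_le_inf; first by case: (opnorm_has_inf f).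
move=> c [c0 hc]; rewrite ler_pdivrMr// -lecR CM -!normCE.
exact: hc.
Qed.

Lemma opnorm_le (f : bop) c : 0 <= c ->
  (forall v, `|f v| <= c%:C * `|v|) -> opnorm f <= c.
Proof.
by move=> c0 hc; apply: ge_inf => //; case: (opnorm_has_inf f).
Qed.

Let norm_bop (f : bop) : R[i] := (opnorm f)%:C.

Let ler_norm_bopD (f g : bop) : norm_bop (f + g) <= norm_bop f + norm_bop g.
Proof.
rewrite /norm_bop -CD lecR; apply: opnorm_le.
  by rewrite addr_ge0 ?opnorm_ge0.
move=> v; rewrite CD mulrDl.
by apply: (le_trans (ler_normD (f v) (g v))); rewrite lerD ?opnormP.
Qed.

Let norm_bop_le (a : R[i]) (f : bop) :
  norm_bop (a *: f) <= `|a| * norm_bop f.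
Proof.
have aE : `|a| = (complex.Re `|a|)%:C by rewrite RRe_real ?normr_real.
rewrite /norm_bop aE -CM lecR; apply: opnorm_le.
  by rewrite mulr_ge0 ?opnorm_ge0// -ler0c -aE.
move=> v; rewrite CM -aE -mulrA.
have -> : (a *: f) v = a *: f v by [].
by rewrite normrZ ler_wpM2l ?opnormP.
Qed.

Let norm_bopZ (a : R[i]) (f : bop) : norm_bop (a *: f) = `|a| * norm_bop f.
Proof.
apply/eqP; rewrite eq_le norm_bop_le /=.
have [->|a0] := eqVneq a 0.
  by rewrite normr0 mul0r /norm_bop lecR opnorm_ge0.
rewrite -ler_pdivlMl ?normr_gt0// -normfV.
by apply: le_trans (norm_bop_le _ _); rewrite scalerA mulVf// scale1r.
Qed.

Let norm_bop0_eq0 (f : bop) : norm_bop f = 0 -> f = 0.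
Proof.
move=> f0; apply/val_inj/funext => v /=.
apply/eqP; rewrite -normr_le0 (le_trans (opnormP f v))//.
by rewrite -/(norm_bop f) f0 mul0r.
Qed.

(* The norm of a normedModType over R[i] takes its values in R[i]. *)
HB.instance Definition _ :=
  Lmodule_isNormed.Build R[i] bop ler_norm_bopD norm_bopZ norm_bop0_eq0.

Lemma id_bounded_op : idfun \in bounded_op.
Proof. by apply/bounded_opP; split=> //; exists 1 => v; rewrite mul1r. Qed.

Definition bop1 : bop := Bop id_bounded_op.

Lemma comp_bounded_op (x y : bop) : x \o y \in bounded_op.
Proof.
have /bounded_opP[lx _] := bop_bounded x.
have /bounded_opP[ly _] := bop_bounded y.
apply/bounded_opP; split=> [a u v|]; first by rewrite /= ly lx.
exists (opnorm x * opnorm y) => v; rewrite CM -mulrA.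
by rewrite (le_trans (opnormP x _))// ler_wpM2l ?opnormP// lecR opnorm_ge0.
Qed.

Definition bop_comp (x y : bop) : bop := Bop (comp_bounded_op x y).

End bounded_operators.
Arguments bop {R} V.

(* By the Riesz theorem, exactly one operator satisfies the defining identity;
   xget selects it. *)
Definition adjoint (R : realType) (F : hilbertType R) (x : bop F) : bop F :=
  xget 0 [set y : bop F | forall u v, '[x u, v] = '[u, y v]].

(* [tens [:: xi_1; ...; xi_n]] is the elementary tensor
   xi_1 (x) ... (x) xi_n, seen in the summand H^{(x) n} of
   F(H) = (+)_n H^{(x) n}, and [tens [::]] is the vacuum.
   The first condition is the inner product of H^{(x) n}, together with the
   orthogonality of the summands (it also makes [tens] multilinear on each
   H^n); the second one says that F is the completed direct sum.  Together
   they determine (F, tens) up to a unique unitary. *)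
Definition is_full_fock (R : realType) (H F : hilbertType R)
    (tens : seq H -> F) : Prop :=
  (forall s t : seq H, '[tens s, tens t] =
     if size s == size t then \prod_(p <- zip s t) '[p.1, p.2] else 0) /\
  closure (lspan (range tens)) = [set: F].

Section peripheral_poisson_boundary.
Context {R : realType} {H F : hilbertType R}.
Variable tens : seq H -> F.

(* The elementary tensors being total, a bounded operator is determined by its
   values on them. *)
Definition creation (xi : H) : bop F :=
  xget 0 [set l : bop F | forall s, l (tens s) = tens (xi :: s)].

Context {Theta : choiceType}.
Variables (e : Theta -> H) (omega : Theta -> R).

(* [summability.sum] is the limit of the finite partial sums.  It is taken here
   for the operator norm, in which the series converges absolutely since
   |omega_i l_i^* x l_i| <= omega_i |x|; the limit is also the strong one. *)
Definition P_omega (x : bop F) : bop F :=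
  summability.sum (fun i : Theta =>
    let l := creation (e i) in
    (omega i)%:C *: bop_comp (adjoint l) (bop_comp x l)).

Definition peripheral_eigenspace (lambda : R[i]) : set (bop F) :=
  [set x | P_omega x = lambda *: x].

Definition unit_circle : set R[i] := [set lambda | `|lambda| = 1].

Definition peripheral_boundary : set (bop F) :=
  closure (lspan (\bigcup_(lambda in unit_circle)
                     peripheral_eigenspace lambda)).

(* [op] is constrained only on the peripheral boundary, where these conditions
   determine it. *)
Record is_choi_effros (op : bop F -> bop F -> bop F) : Prop := {
  choi_effros_closed : forall x y, peripheral_boundary x ->
    peripheral_boundary y -> peripheral_boundary (op x y) ;
  choi_effros_linearl : forall (a : R[i]) x x' y, peripheral_boundary x ->
    peripheral_boundary x' -> peripheral_boundary y ->
    op (a *: x + x') y = a *: op x y + op x' y ;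
  choi_effros_linearr : forall (a : R[i]) x y y', peripheral_boundary x ->
    peripheral_boundary y -> peripheral_boundary y' ->
    op x (a *: y + y') = a *: op x y + op x y' ;
  choi_effros_continuous :
    {within peripheral_boundary `*` peripheral_boundary,
      continuous (fun z : bop F * bop F => op z.1 z.2)} ;
  choi_effros_lim : forall (lambda mu : R[i]) x y,
    unit_circle lambda -> unit_circle mu ->
    peripheral_eigenspace lambda x -> peripheral_eigenspace mu y ->
    forall v : F,
      ((lambda * mu) ^- m *: iter m P_omega (bop_comp x y)) v @[m --> \oo]
        --> op x y v
}.

End peripheral_poisson_boundary.

(* Main.v *)
(** For xi in H let r_xi be the right creation operator, and for mu in the circle
    let U_mu be the gauge unitary, acting on H^{(x) n} as mu^n.  Right creation
    and the gauge unitaries commute, respectively commute up to mu, with the left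
    creation operators, so P_omega fixes r_xi and U_mu lies in E_mu.  For x in
    the boundary, x o r_xi = x r_xi, x o U_mu = x U_mu and U_mu o x = U_mu x,
    while r_xi o x differs from r_xi x by an operator with range in the vacuum
    line.  Hence a central x commutes with the gauge unitaries, so it preserves
    the degree, and satisfies r_xi^* x r_eta = <eta, xi> x.  Removing the
    letters of two tensors of equal degree from the right, one finds that the
    matrix entries of x are <x Omega, Omega> times those of 1. *)

Require Import Defs.
From HB Require Import structures.
From mathcomp Require Import all_boot all_order all_algebra finmap.
From mathcomp Require Import sesquilinear complex.
From mathcomp Require Import all_classical all_reals all_analysis.
From mathcomp Require Import ring.
From mathcomp Require summability.

Set Implicit Arguments.
Unset Strict Implicit.
Unset Printing Implicit Defensive.

Import Order.TTheory GRing.Theory Num.Theory.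
Import numFieldNormedType.Exports.

Local Open Scope classical_set_scope.
Local Open Scope ring_scope.
Local Open Scope complex_scope.

(** * Hilbert spaces and bounded operators *)

Section hilbert_space.
Context {R : realType} {F : hilbertType R}.
Implicit Types (u v w : F) (a : R[i]).

Lemma hdotDl u v w : '[u + v, w] = '[u, w] + '[v, w].
Proof. exact: linearDl. Qed.

Lemma hdotBl u v w : '[u - v, w] = '[u, w] - '[v, w].
Proof. exact: linearBl. Qed.

Lemma hdotZl a u w : '[a *: u, w] = a * '[u, w].
Proof. exact: linearZl_LR. Qed.

Lemma hdotC u v : '[u, v] = Num.conj '[v, u].
Proof. by rewrite hermC expr0 mul1r. Qed.

Lemma hdotDr u v w : '[w, u + v] = '[w, u] + '[w, v].
Proof. exact: linearDr. Qed.

Lemma hdotZr a u w : '[w, a *: u] = Num.conj a * '[w, u].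
Proof. exact: linearZr_LR. Qed.

Lemma hdotBr u v w : '[w, u - v] = '[w, u] - '[w, v].
Proof. exact: linearBr. Qed.

Lemma hdot0l w : '[0, w] = 0.
Proof. exact: linear0l. Qed.

Lemma hdot_suml (I : Type) (r : seq I) (f : I -> F) w :
  '[\sum_(i <- r) f i, w] = \sum_(i <- r) '[f i, w].
Proof. by elim/big_rec2 : _ => [|i y x _ <-]; rewrite ?hdot0l ?hdotDl. Qed.

(** Write [u] as [t + b v] with [t] orthogonal to [v]; then |u|^2 = |t|^2 + |b|^2 |v|^2, and
    dropping |t|^2 gives the bound. *)
Lemma hdot_CauchySchwarz u v : `|'[u, v]| <= `|u| * `|v|.
Proof.
have [->|v0] := eqVneq v 0.
  by rewrite [X in `|X|]linear0r !normr0 mulr0.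
rewrite -(@ler_pXn2r _ 2) ?nnegrE ?mulr_ge0// exprMn !hdotE.
pose b := '[u, v] / '[v, v].
have vv : 0 < '[v, v] by exact: neq0_dnorm_gt0.
have [t -> tv] : exists2 t, u = t + b *: v & '[t, v] = 0.
  exists (u - b *: v); first by rewrite subrK.
  by rewrite hdotBl hdotZl divfK ?subrr// gt_eqF.
rewrite hdotDl tv add0r hdotZl normrM (ger0_norm (ltW vv)).
rewrite exprMn hdotDl !hdotDr !hdotZl !hdotZr tv mulr0 addr0.
have -> : '[v, t] = 0 by rewrite hdotC tv conjC0.
by rewrite mulr0 add0r mulrDl normCK -!mulrA lerDr mulr_ge0.
Qed.

Lemma hdot_cvgl {T : Type} (G : set_system T) {FG : Filter G} (f : T -> F) u v :
  f @ G --> u -> (fun t => '[f t, v] : R[i]^o) @ G --> ('[u, v] : R[i]^o).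
Proof.
move=> /cvgrPdist_lt fu; apply/cvgrPdist_lt => eps eps0.
(* The added 1 keeps the divisor positive when [v] is 0; the same device recurs below. *)
have c0 : 0 < eps / (`|v| + 1) by rewrite divr_gt0// ltr_wpDl.
near=> t.
rewrite -hdotBl (le_lt_trans (hdot_CauchySchwarz _ _))//.
have : `|u - f t| < eps / (`|v| + 1) by near: t; exact: fu.
rewrite ltr_pdivlMr ?ltr_wpDl//; apply: le_lt_trans.
by rewrite ler_wpM2l// lerDl.
Unshelve. all: by end_near.
Qed.

(** The difference d of the two vectors is orthogonal to the span. For w in the span, |d|^2 = <d, d
    - w> <= |d| |d - w|, and density makes |d - w| arbitrarily small. *)
Lemma hdot_inj_total (A : set F) u v : closure (lspan A) = [set: F] ->
  (forall w, A w -> '[u, w] = '[v, w]) -> u = v.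
Proof.
move=> Atotal uv; apply/eqP; rewrite -subr_eq0 -normr_le0.
have d0 w : lspan A w -> '[u - v, w] = 0.
  move=> [s sA ->]; rewrite hdotC hdot_suml big_seq big1 ?conjC0// => p ps.
  by rewrite hdotZl hdotC hdotBl uv ?subrr ?conjC0 ?mulr0//; exact: sA.
apply/ler_addgt0Pl => eps eps0; rewrite addr0.
have : closure (lspan A) (u - v) by rewrite Atotal.
move=> /(_ (ball (u - v) eps)) []; first exact: nbhsx_ballx.
move=> w [Aw]; rewrite -ball_normE /= => uvw.
rewrite (le_trans _ (ltW uvw))//.
have [->|uv0] := eqVneq (u - v) 0; first by rewrite normr0.
rewrite -(@ler_pM2l _ `|u - v|) ?normr_gt0//.
rewrite (le_trans _ (hdot_CauchySchwarz _ _))//.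
rewrite hdotBr (d0 w)// subr0 -hdotE.
by rewrite ger0_norm ?exprn_ge0.
Qed.

End hilbert_space.

(** * Extension of bounded linear maps from a total family *)

Section bounded_extension.
Context {R : realType} {V : normedModType R[i]} {W : completeNormedModType R[i]}.
Context {I : Type} (f : I -> V) (g : I -> W) (C : R).
Hypothesis f_total : closure (lspan (range f)) = [set: V].

(** A formal combination is a list of coefficients and indices, so that the same list can be
    evaluated in [f] and in [g] even when [f] is linearly dependent. *)
Definition lcomb (U : lmodType R[i]) (h : I -> U) (s : seq (R[i] * I)) : U :=
  \sum_(p <- s) p.1 *: h p.2.

Lemma lcomb_cat (U : lmodType R[i]) (h : I -> U) s t :
  lcomb h (s ++ t) = lcomb h s + lcomb h t.
Proof. by rewrite /lcomb big_cat. Qed.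

Lemma lcombZ (U : lmodType R[i]) (h : I -> U) a s :
  lcomb h [seq (a * p.1, p.2) | p <- s] = a *: lcomb h s.
Proof.
by rewrite /lcomb big_map scaler_sumr; apply: eq_bigr => p _; rewrite scalerA.
Qed.

Lemma lcomb1 (U : lmodType R[i]) (h : I -> U) i : lcomb h [:: (1, i)] = h i.
Proof. by rewrite /lcomb big_seq1 scale1r. Qed.

Lemma lcomb_approx v (eps : R[i]) : 0 < eps ->
  exists s, `|v - lcomb f s| < eps.
Proof.
move=> eps0; have : closure (lspan (range f)) v by rewrite f_total.
move=> /(_ (ball v eps)) []; first exact: nbhsx_ballx.
move=> w [[s sf ->]]; rewrite -ball_normE /= => vs.
have [t ts] : exists t, lcomb f t = \sum_(p <- s) p.1 *: p.2.
  elim: s sf {vs} => [_|[a u] s IH sf].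
    by exists [::]; rewrite /lcomb !big_nil.
  have [|t ts] := IH; first by move=> p ps; apply: sf; rewrite inE ps orbT.
  have [i _ /= fi] := sf _ (mem_head _ _).
  by exists ((a, i) :: t); rewrite /lcomb !big_cons /= fi -ts.
by exists t; rewrite ts.
Qed.

Hypothesis C_gt0 : 0 < C.
Hypothesis fgC : forall s, `|lcomb g s| <= C%:C * `|lcomb f s|.

Let fgC_dist s t : `|lcomb g s - lcomb g t| <= C%:C * `|lcomb f s - lcomb f t|.
Proof.
have E (U : lmodType R[i]) (h : I -> U) : lcomb h s - lcomb h t =
    lcomb h (s ++ [seq (-1 * p.1, p.2) | p <- t]).
  by rewrite lcomb_cat lcombZ scaleN1r.
by rewrite !E.
Qed.

(** The value at [v] is the limit of [lcomb g s] along the lists [s] whose combination [lcomb f s]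
    tends to [v]. The bound [fgC] makes this filter Cauchy, and the estimate is what survives in the
    limit. *)
Let ext_ex v : exists w : W, forall s, `|w - lcomb g s| <= C%:C * `|v - lcomb f s|.
Proof.
pose G := filter_from [set e : R[i] | 0 < e]
  (fun e => [set s | `|v - lcomb f s| < e]).
have PG : ProperFilter G.
  apply: filter_from_proper; last by move=> e /= e0; exact: lcomb_approx.
  apply: filter_from_filter; first by exists 1 => /=.
  move=> a b /= a0 b0; exists (Num.min a b); first by rewrite /= /Order.min; case: ifP.
  (* The order of [R[i]] is partial, but positive elements are real and hence comparable, so the
     minimum behaves as usual. *)
  have ab : (a >=< b)%R by apply: real_comparable; exact: gtr0_real.
  by move=> s /=; rewrite comparable_lt_min => [/andP[]|].
have Gnear (e : R[i]) : 0 < e -> \forall s \near G, `|v - lcomb f s| < e.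
  by move=> e0; exists e.
have C0 : 0 < C%:C :> R[i] by rewrite ltcR.
have gC s t : `|lcomb g s - lcomb g t| <=
    C%:C * (`|v - lcomb f s| + `|v - lcomb f t|).
  rewrite (le_trans (fgC_dist s t))//; apply: ler_wpM2l; first exact: ltW.
  by rewrite [X in _ <= X + _]distrC ler_distD.
have : cauchy (lcomb g @ G).
  apply: cauchy_exP => e e0.
  (* Two approximation errors of this size, multiplied by [C], add up to [e]. *)
  have e1 : 0 < e / (C%:C * 2) by rewrite divr_gt0// mulr_gt0.
  have [s vs] := lcomb_approx v e1.
  exists (lcomb g s); rewrite -ball_normE.
  change (\forall t \near G, `|lcomb g s - lcomb g t| < e); near=> t.
  have vt : `|v - lcomb f t| < e / (C%:C * 2) by near: t; exact: Gnear e1.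
  rewrite (le_lt_trans (gC s t))//.
  have -> : e = C%:C * (e / (C%:C * 2) + e / (C%:C * 2)).
    by field; rewrite gt_eqF.
  by rewrite ltr_pM2l// ltrD.
move=> /cauchy_cvg/cvg_ex[w gw]; exists w => s.
apply/ler_addgt0Pl => e e0.
(* This error occurs once for the limit [w] and once, multiplied by [C], for [v]. *)
have e1 : 0 < e / (1 + C%:C) by rewrite divr_gt0// ltr_wpDl.
near G => t.
have wt : `|w - lcomb g t| < e / (1 + C%:C).
  by near: t; exact: (@cvgr_dist_lt _ _ _ _ _ _ _ gw).
have vt : `|v - lcomb f t| < e / (1 + C%:C) by near: t; exact: Gnear.
rewrite (le_trans (ler_distD (lcomb g t) _ _))//.
rewrite (le_trans (lerD (ltW wt) (gC t s)))// mulrDr addrA lerD2r.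
rewrite (le_trans (lerD (lexx _) (ler_wpM2l (ltW C0) (ltW vt))))//.
by rewrite -[X in X + _]mul1r -mulrDl mulrC divfK// gt_eqF// ltr_wpDl.
Unshelve. all: by end_near.
Qed.

(** Everything follows from the estimate of [ext_ex]: a singleton list gives the value at [f i], the
    empty list gives the bound, and linearity comes from approximating [u] and [v] by lists. *)
Lemma bounded_extension : exists2 T : V -> W,
    linear T /\ (exists c : R, forall v, `|T v| <= c%:C * `|v|) &
    forall i, T (f i) = g i.
Proof.
have [T Tv] := choice ext_ex.
have C0 : 0 < C%:C :> R[i] by rewrite ltcR.
exists T; last first.
  move=> i; apply/eqP; rewrite -subr_eq0 -normr_le0 -(lcomb1 g).
  by rewrite (le_trans (Tv _ _))// lcomb1 subrr normr0 mulr0.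
split; last first.
  exists C => v; have := Tv v [::].
  by rewrite /lcomb !big_nil !subr0.
move=> a u v; apply/eqP; rewrite -subr_eq0 -normr_le0.
apply/ler_addgt0Pl => e e0; rewrite addr0.
(* Chosen so that [a u + v] is approximated within e / (2C). The error is then counted twice: for
   [T] at [a u + v], and for [T u] and [T v] together. *)
have e1 : 0 < e / (C%:C * ((`|a| + 1) * 2)).
  by rewrite divr_gt0// !mulr_gt0// ltr_wpDl.
have [s us] := lcomb_approx u e1; have [t vt] := lcomb_approx v e1.
pose r := [seq (a * p.1, p.2) | p <- s] ++ t.
have rE (U : lmodType R[i]) (h : I -> U) : lcomb h r = a *: lcomb h s + lcomb h t.
  by rewrite lcomb_cat lcombZ.
have lin_dist (U : normedModType R[i]) (x x' y y' : U) :
    `|a *: x + y - (a *: x' + y')| <= `|a| * `|x - x'| + `|y - y'|.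
  by rewrite opprD addrACA -scalerBr (le_trans (ler_normD _ _))// normrZ.
have := lin_dist _ u (lcomb f s) v (lcomb f t).
have := lin_dist _ (lcomb g s) (T u) (lcomb g t) (T v).
rewrite -!rE => gT fuv.
rewrite (le_trans (ler_distD (lcomb g r) _ _))//.
rewrite (le_trans (lerD (Tv _ _) gT))//.
rewrite ![in leLHS](distrC (lcomb g _)).
have est : `|a| * `|u - lcomb f s| + `|v - lcomb f t| <= e / (C%:C * 2).
  rewrite (le_trans (lerD (ler_wpM2l _ (ltW us)) (ltW vt)))//.
  rewrite -[X in _ + X]mul1r -mulrDl le_eqVlt; apply/orP; left; apply/eqP.
  have E (K : numFieldType) (b d c : K) : b != 0 -> c != 0 ->
      b * (d / (c * (b * 2))) = d / (c * 2) by move=> *; field; apply/andP.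
  by apply: E; rewrite gt_eqF// ltr_wpDl.
rewrite (@le_trans _ _ (C%:C * (e / (C%:C * 2)) + C%:C * (e / (C%:C * 2))))//.
  have fr := ler_wpM2l (ltW C0) (le_trans fuv est).
  apply: lerD => //.
  rewrite (le_trans _ (ler_wpM2l (ltW C0) est))// mulrDr mulrCA.
  by apply: lerD => //; apply: ler_wpM2l.
by rewrite le_eqVlt; apply/orP; left; apply/eqP; field; rewrite gt_eqF.
Qed.
End bounded_extension.

(** * Operators tested on a total family: equality, adjoints, homotheties *)

Section bounded_operators.
Context {R : realType} {F : hilbertType R}.
Implicit Types (x y : bop F) (u v w : F).

Lemma bop_linear x : linear x.
Proof. by have /bounded_opP[] := bop_bounded x. Qed.

Lemma bopB x u v : x (u - v) = x u - x v.
Proof.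
by rewrite -scaleN1r addrC bop_linear addrC scaleN1r.
Qed.

Lemma bop_0 x : x 0 = 0.
Proof. by have := bopB x 0 0; rewrite !subrr. Qed.

Lemma bop_lcomb x (I : Type) (f : I -> F) s : x (lcomb f s) = lcomb (x \o f) s.
Proof.
rewrite /lcomb; elim: s => [|p s IH]; first by rewrite !big_nil bop_0.
by rewrite !big_cons bop_linear IH.
Qed.

Lemma hdot_bop_le x u v : `|'[x u, v]| <= (opnorm x)%:C * `|u| * `|v|.
Proof.
rewrite (le_trans (hdot_CauchySchwarz _ _))// ler_wpM2r//.
exact: opnormP.
Qed.

Context {I : Type} (f : I -> F).
Hypothesis f_total : closure (lspan (range f)) = [set: F].

Lemma bop_total_extension (g : I -> F) (C : R) : 0 < C ->
    (forall s, `|lcomb g s| <= C%:C * `|lcomb f s|) ->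
  exists x, forall i, x (f i) = g i.
Proof.
move=> C0 fg.
have [T Tb Tf] := bounded_extension f_total C0 fg.
have Tb' : T \in bounded_op by exact/bounded_opP.
by exists (Bop Tb').
Qed.

(** Density in quantitative form: the assumed estimate is what a bounded linear discrepancy
    vanishing on the combinations of [f] satisfies, and its right-hand side can be made arbitrarily
    small. *)
Lemma eq_on_total (W : normedZmodType R[i]) (phi psi : F -> W) (c : R[i]) :
    0 <= c -> (forall v s, `|phi v - psi v| <= c * `|v - lcomb f s|) ->
  phi =1 psi.
Proof.
move=> c0 hc v; apply/eqP; rewrite -subr_eq0 -normr_le0.
apply/ler_addgt0Pl => e e0; rewrite addr0.
have c1 : 0 < c + 1 by rewrite ltr_wpDl.
have [s vs] := lcomb_approx f_total v (divr_gt0 e0 c1).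
rewrite (le_trans (hc v s))// (@le_trans _ _ ((c + 1) * `|v - lcomb f s|))//.
  by rewrite ler_wpM2r// lerDl.
by rewrite mulrC -ler_pdivlMr// ltW.
Qed.

Lemma bop_eq_total x y : (forall i, x (f i) = y (f i)) -> x = y.
Proof.
move=> xy; apply/val_inj/funext => /=.
apply: (@eq_on_total _ _ _ (opnorm (x - y))%:C); first by rewrite ler0c opnorm_ge0.
move=> v s; rewrite -[X in `|X|]/((x - y) v).
have xys : lcomb ((x - y) \o f) s = 0.
  rewrite /lcomb big1// => p _.
  have -> : ((x - y) \o f) p.2 = x (f p.2) - y (f p.2) by [].
  by rewrite xy subrr scaler0.
suff -> : (x - y) v = (x - y) (v - lcomb f s) by exact: opnormP.
by rewrite bopB bop_lcomb xys subr0.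
Qed.

(** Here [w'] stands for the adjoint of [x] at [w], which can thus be identified on the total family
    before the adjoint operator is constructed. *)
Lemma hdot_bop_total x w w' : (forall i, '[x (f i), w] = '[f i, w']) ->
  forall u, '[x u, w] = '[u, w'].
Proof.
move=> xw; apply: (@eq_on_total R[i] (fun u => '[x u, w]) (fun u => '[u, w'])
  ((opnorm x)%:C * `|w| + `|w'|)).
  by rewrite addr_ge0// mulr_ge0// ler0c opnorm_ge0.
move=> v s.
have -> : '[x v, w] - '[v, w'] =
    '[x (v - lcomb f s), w] - '[v - lcomb f s, w'].
  have xwE : '[lcomb (x \o f) s, w] = '[lcomb f s, w'].
    rewrite /lcomb !hdot_suml; apply: eq_bigr => p _.
    by rewrite !hdotZl /= xw.
  rewrite bopB !hdotBl bop_lcomb xwE.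
  by rewrite opprB addrA subrK.
rewrite (le_trans (ler_normB _ _))// mulrDl lerD//.
  by rewrite mulrAC hdot_bop_le.
by rewrite mulrC hdot_CauchySchwarz.
Qed.

(** The prescribed values [h] extend to an operator: for w = [lcomb h s], |w|^2 = <x w, lcomb f s>
    is at most |x| |w| |lcomb f s|, and |w| cancels. *)
Lemma adjoint_ex x (h : I -> F) : (forall u i, '[x u, f i] = '[u, h i]) ->
  exists y, forall u v, '[x u, v] = '[u, y v].
Proof.
move=> xh; pose c := opnorm x + 1.
have c0 : 0 < c by rewrite ltr_wpDl// opnorm_ge0.
have cc : (0 : R[i]) <= c%:C by rewrite ler0c ltW.
have [|y yE] := @bop_total_extension h c c0.
  move=> s; set w := lcomb h s.
  have [->|w0] := eqVneq w 0; first by rewrite normr0 mulr_ge0.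
  rewrite -(@ler_pM2r _ `|w|) ?normr_gt0// -expr2 hdotE.
  have ww0 : 0 <= '[w, w] by rewrite -hdotE exprn_ge0.
  rewrite -(ger0_norm ww0); have -> : '[w, w] = '[x w, lcomb f s].
    rewrite {2}/w hdotC [RHS]hdotC; congr Num.conj.
    rewrite !hdot_suml; apply: eq_bigr => p _.
    by rewrite !hdotZl hdotC -xh -hdotC.
  rewrite (le_trans (hdot_bop_le _ _ _))// mulrAC ler_wpM2r// ler_wpM2r//.
  by rewrite lecR lerDl.
exists y => u v; rewrite hdotC [RHS]hdotC; congr Num.conj; apply/esym.
by apply: (hdot_bop_total (w' := x u)) => i; rewrite yE hdotC -xh -hdotC.
Qed.

(** The norm of a combination depends only on the Gram matrix of the family, which is scaled by [c]
    squared. *)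
Lemma lcomb_homothety (g : I -> F) (c : R) : 0 <= c ->
    (forall i j, '[g i, g j] = c%:C ^+ 2 * '[f i, f j]) ->
  forall s, `|lcomb g s| = c%:C * `|lcomb f s|.
Proof.
move=> c0 fg s; apply/eqP.
have c0' : (0 : R[i]) <= c%:C by rewrite ler0c.
rewrite -(@eqrXn2 _ 2)// ?mulr_ge0// exprMn !hdotE; apply/eqP.
rewrite !hdot_suml mulr_sumr; apply: eq_bigr => p _.
rewrite !hdotZl hdotC [X in _ = _ * (_ * X)]hdotC !hdot_suml.
rewrite mulrCA; congr (_ * _).
rewrite !rmorph_sum/= mulr_sumr; apply: eq_bigr => q _.
by rewrite !hdotZl !rmorphM /= -!hdotC fg mulrCA.
Qed.

Lemma bop_homothety (g : I -> F) (c : R) : 0 <= c ->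
    (forall i j, '[g i, g j] = c%:C ^+ 2 * '[f i, f j]) ->
  exists x, forall i, x (f i) = g i.
Proof.
(* The extension asks for a positive constant, while [c] may be 0. *)
move=> c0 fg; apply: (@bop_total_extension g (c + 1)).
  by rewrite ltr_wpDl.
move=> s; rewrite (lcomb_homothety c0 fg) ler_wpM2r//.
by rewrite lecR lerDl.
Qed.

End bounded_operators.

(** * Operators on the full Fock space *)

Section fock_space.
Context {R : realType} {H F : hilbertType R} (tens : seq H -> F).
Hypothesis hF : is_full_fock tens.
Implicit Types (xi eta : H) (s t : seq H).

Lemma tens_total : closure (lspan (range tens)) = [set: F].
Proof. by case: hF. Qed.

Lemma hdot_tens s t : '[tens s, tens t] =
  if size s == size t then \prod_(p <- zip s t) '[p.1, p.2] else 0.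
Proof. by case: hF => + _; exact. Qed.

Lemma hdot_vacuum : '[tens [::], tens [::]] = 1.
Proof. by rewrite hdot_tens/= big_nil. Qed.

Lemma hdot_tens_cons xi eta s t :
  '[tens (xi :: s), tens (eta :: t)] = '[xi, eta] * '[tens s, tens t].
Proof.
by rewrite !hdot_tens /= eqSS; case: eqP => _; rewrite ?mulr0// big_cons.
Qed.

Lemma hdot_tens_rcons xi eta s t :
  '[tens (rcons s xi), tens (rcons t eta)] = '[xi, eta] * '[tens s, tens t].
Proof.
rewrite !hdot_tens !size_rcons eqSS; case: eqP => st; last by rewrite mulr0.
by rewrite zip_rcons// big_rcons /= mulrC.
Qed.

Lemma hdot_tens_size s t : size s != size t -> '[tens s, tens t] = 0.
Proof. by rewrite hdot_tens => /negbTE ->. Qed.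

Let normE (xi : H) : `|xi| = (complex.Re `|xi|)%:C.
Proof. by rewrite RRe_real ?normr_real. Qed.

Let Re_norm_ge0 (xi : H) : 0 <= complex.Re `|xi|.
Proof. by rewrite -ler0c -normE. Qed.

(** Prefixing [xi] scales the Gram matrix of the elementary tensors by |xi|^2, so the operator
    exists and [xget] does not fall back on its default 0. *)
Lemma creationE xi s : creation tens xi (tens s) = tens (xi :: s).
Proof.
have [l lE] : exists l : bop F, forall s, l (tens s) = tens (xi :: s).
  apply: (bop_homothety tens_total (Re_norm_ge0 xi)) => s' t'.
  by rewrite hdot_tens_cons -normE hdotE.
move: s; rewrite /creation.
by case: xgetP => [_ -> //|/(_ l)].
Qed.

(** The new letter sits at the end opposite to the one where left creation acts, so the two
    operations commute. *)
Lemma right_creation_ex xi :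
  exists r : bop F, forall s, r (tens s) = tens (rcons s xi).
Proof.
apply: (bop_homothety tens_total (Re_norm_ge0 xi)) => s t.
by rewrite hdot_tens_rcons -normE hdotE.
Qed.

(** The Gram matrix is preserved: different degrees are orthogonal, and within one degree the two
    phases cancel. *)
Lemma gauge_ex (mu : R[i]) : `|mu| = 1 ->
  exists U : bop F, forall s, U (tens s) = mu ^+ size s *: tens s.
Proof.
move=> mu1; apply: (bop_homothety tens_total (@ler01 R)) => s t.
rewrite expr1n mul1r hdotZl hdotZr.
have [st|/hdot_tens_size ->] := eqVneq (size s) (size t); last by rewrite !mulr0.
by rewrite st mulrA -normCK normrX mu1 !expr1n mul1r.
Qed.

Lemma adjoint_creationE xi (u v : F) :
  '[creation tens xi u, v] = '[u, adjoint (creation tens xi) v].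
Proof.
(* The annihilation operator on elementary tensors: it removes the first letter and kills the
   vacuum. *)
pose h s := if s is eta :: t then '[eta, xi] *: tens t else 0.
have [|y yE] := @adjoint_ex _ _ _ _ tens_total (creation tens xi) h.
  move=> w s; apply: (hdot_bop_total tens_total) => t; rewrite creationE.
  case: s => [|eta s]; last by rewrite hdot_tens_cons hdotZr -hdotC.
  by rewrite hdot_tens_size// hdotC hdot0l conjC0.
rewrite /adjoint; case: xgetP => [_ -> //|/(_ y)[]].
exact: yE.
Qed.

Lemma creation_isometry xi u v : `|xi| = 1 ->
  '[creation tens xi u, creation tens xi v] = '[u, v].
Proof.
move=> xi1.
apply: (hdot_bop_total tens_total) => s; rewrite hdotC [RHS]hdotC; congr Num.conj.
apply: (hdot_bop_total tens_total) => t.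
by rewrite !creationE hdot_tens_cons -hdotE xi1 expr1n mul1r.
Qed.

(** The adjoint of [r] strips the last letter of the target. The target has a last letter, which
    leaves out the vacuum, killed by that adjoint. *)
Lemma hdot_right_creation (r : bop F) eta :
    (forall s, r (tens s) = tens (rcons s eta)) ->
  forall u xi t, '[r u, tens (rcons t xi)] = '[eta, xi] * '[u, tens t].
Proof.
move=> rE u xi t.
rewrite (hdot_bop_total tens_total (w' := '[xi, eta] *: tens t)).
  by rewrite hdotZr -hdotC.
by move=> s; rewrite rE hdot_tens_rcons hdotZr -hdotC.
Qed.

Lemma hdot_gauge (U : bop F) (mu : R[i]) :
    (forall s, U (tens s) = mu ^+ size s *: tens s) ->
  forall u t, '[U u, tens t] = mu ^+ size t * '[u, tens t].
Proof.
move=> UE u t.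
rewrite (hdot_bop_total tens_total (w' := Num.conj (mu ^+ size t) *: tens t)).
  by rewrite hdotZr conjCK.
move=> s; rewrite UE hdotZl hdotZr conjCK.
by have [->//|/hdot_tens_size ->] := eqVneq (size s) (size t); rewrite !mulr0.
Qed.

Lemma bop_eq_tens (x y : bop F) :
  (forall s t, '[x (tens s), tens t] = '[y (tens s), tens t]) -> x = y.
Proof.
move=> xy; apply: (bop_eq_total tens_total) => s.
by apply: (hdot_inj_total tens_total) => _ [t _ <-].
Qed.

End fock_space.

(** * Norm convergence of the series defining [P_omega] *)

Section complete_bop.
Context {R : realType}.

Lemma bopBE (V : normedModType R[i]) (x y : bop V) v : (x - y) v = x v - y v.
Proof. by []. Qed.

Lemma bop_norm_le (V : normedModType R[i]) (x : bop V) (c : R[i]) : 0 <= c ->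
  (forall v, `|x v| <= c * `|v|) -> `|x| <= c.
Proof.
move=> c0 xc; have cE : c = (complex.Re c)%:C by rewrite RRe_real ?ger0_real.
rewrite cE; change ((opnorm x)%:C <= (complex.Re c)%:C); rewrite lecR.
by apply: opnorm_le; [rewrite -ler0c -cE|rewrite -cE].
Qed.

Lemma bop_normP (V : normedModType R[i]) (x : bop V) v : `|x v| <= `|x| * `|v|.
Proof. exact: opnormP. Qed.

(** Completeness for the operator norm: a Cauchy filter converges pointwise, and the pointwise limit
    turns out to be bounded and to be the norm limit. *)
Lemma bop_cauchy_cvg (V : completeNormedModType R[i]) (G : set_system (bop V))
  {PG : ProperFilter G} : cauchy G -> cvg G.
Proof.
move=> /cauchyP Gc.
have evalG v : cvg ((fun x : bop V => x v) @ G).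
  apply: cauchy_cvg; apply: cauchy_exP => e e0.
  have v1 : 0 < `|v| + 1 by rewrite ltr_wpDl.
  have [y Gy] := Gc _ (divr_gt0 e0 v1).
  exists (y v).
  change (G [set x : bop V | ball (y v) (e : R[i]) (x v)]).
  apply: filterS Gy => x; rewrite -!ball_normE /= => yx.
  rewrite -bopBE (le_lt_trans (bop_normP _ _))//.
  rewrite (@le_lt_trans _ _ (`|y - x| * (`|v| + 1)))//.
    by rewrite ler_wpM2l// lerDl.
  by rewrite -ltr_pdivlMr.
pose T v := lim ((fun x : bop V => x v) @ G).
have TG v : (fun x : bop V => x v) @ G --> T v by exact: evalG.
(* Norm balls pass to the pointwise limit uniformly in [v]. Radius 1 yields boundedness of [T],
   small radii yield norm convergence. *)
have Tball y r v : G (ball y r) -> `|T v - y v| <= r * `|v|.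
  move=> Gy; apply/ler_addgt0Pl => e e0; near G => x.
  have xT : `|T v - x v| < e by near: x; exact: (@cvgr_dist_lt _ _ _ _ _ _ _ (TG v)).
  have : ball y r x by near: x.
  rewrite -ball_normE /= distrC => yx.
  rewrite (le_trans (ler_distD (x v) _ _))//; apply: lerD; first exact: ltW.
  rewrite -bopBE (le_trans (bop_normP _ _))//.
  by rewrite ler_wpM2r// ltW.
have Tb : T \in bounded_op.
  apply/bounded_opP; split=> [a u v|].
    have /cvg_unique := TG (a *: u + v); apply => //.
    have -> : (fun x : bop V => x (a *: u + v)) =
        (fun x : bop V => a *: x u + x v).
      apply/funext => x; have /bounded_opP[-> //] := bop_bounded x.
    by apply: cvgD => //; apply: cvgZl_tmp.
  have [y Gy] := Gc _ ltr01.
  exists (opnorm y + 1) => v; rewrite -[T v](subrK (y v)).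
  rewrite (le_trans (ler_normD _ _))// rmorphD/= mulrDl addrC lerD//.
    exact: opnormP.
  exact: Tball.
apply/cvg_ex; exists (Bop Tb); apply/cvgrPdist_lt => e e0.
have e2 : 0 < e / 2 by rewrite divr_gt0.
have [y Gy] := Gc _ e2.
apply: filterS (Gy) => x; rewrite -ball_normE /= => yx.
rewrite [ltRHS]splitr (le_lt_trans (ler_distD y _ _))// ler_ltD//.
by apply: bop_norm_le => [|v]; [exact: ltW|exact: Tball].
Unshelve. all: by end_near.
Qed.

End complete_bop.

Import summability.

#[local] Existing Instance totally_filter.

Section absolute_summability.
Context {R : realType} {Theta : choiceType} (omega : Theta -> R).
Hypothesis omega_gt0 : forall i, 0 < omega i.
Hypothesis omega_sum : (\esum_(i in [set: Theta]) (omega i)%:E = 1)%E.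
Implicit Types A B : {fset Theta}.

Lemma fsum_weights_le1 A : \sum_(i <- A) omega i <= 1.
Proof.
rewrite -lee_fin -omega_sum -sumEFin.
apply: esum_ge; exists [set` A]; first by split.
by rewrite fsbig_finite// set_fsetK.
Qed.

Lemma fsum_weights_approx (d : R) : 0 < d ->
  exists A, 1 - d < \sum_(i <- A) omega i.
Proof.
move=> d0.
have : ((1 - d)%:E < \esum_(i in [set: Theta]) (omega i)%:E)%E.
  by rewrite omega_sum lte_fin ltrBlDr ltrDl.
rewrite /esum => /ereal_sup_gt[_ [A [finA _] <-]].
by rewrite fsbig_finite// sumEFin lte_fin => ?; exists (fset_set A).
Qed.

Lemma fsum_subset (U : zmodType) (f : Theta -> U) A B : (A `<=` B)%fset ->
  \sum_(i <- B) f i - \sum_(i <- A) f i = \sum_(i <- B | i \notin A) f i.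
Proof.
move=> AB; rewrite (bigID (fun i => i \in A))/=.
rewrite [X in X + _ - _](_ : _ = \sum_(i <- A) f i); first by rewrite addrC addKr.
rewrite -big_filter; apply/perm_big/uniq_perm; rewrite ?filter_uniq//.
move=> i; rewrite mem_filter; apply: andb_idr.
exact: (fsubsetP AB).
Qed.

Lemma weights_cvg1 :
  (fun A => \sum_(i <- A) (omega i)%:C : R[i]^o) @ totally --> (1 : R[i]^o).
Proof.
apply/cvgrPdist_lt => e e0.
have eE : e = (complex.Re e)%:C by rewrite RRe_real ?gtr0_real.
have e0' : 0 < complex.Re e by rewrite -ltcR -eE.
have [A hA] := fsum_weights_approx e0'.
exists A => // B /= AB.
rewrite -rmorph_sum/= -(rmorph1 (real_complex R)) -rmorphB/= eE.
rewrite ger0_norm ?ler0c ?subr_ge0 ?fsum_weights_le1// ltcR.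
rewrite ltrBlDr -ltrBlDl (lt_le_trans hA)//.
rewrite -subr_ge0 fsum_subset// sumr_ge0// => i _; exact: ltW.
Qed.

(** Outside a finite set [A] of weight above 1 - e / (M + 1), any finite sum of terms has norm at
    most M e / (M + 1) < e. *)
Lemma weighted_family_cvg (V : completeNormedModType R[i]) (T : Theta -> bop V)
    (M : R) : 0 <= M -> (forall i, `|T i| <= (omega i)%:C * M%:C) ->
  cvg (partial_sum T @ totally).
Proof.
move=> M0 TM; apply: bop_cauchy_cvg; apply: cauchy_exP => e e0.
have eE : e = (complex.Re e)%:C by rewrite RRe_real ?gtr0_real.
have e0' : 0 < complex.Re e by rewrite -ltcR -eE.
have M1 : 0 < M + 1 by rewrite ltr_wpDl.
have [A hA] := fsum_weights_approx (divr_gt0 e0' M1).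
exists (partial_sum T A); exists A => // B /= AB.
rewrite -ball_normE /= /partial_sum distrC -!(big_seq_fsetE _ _ predT T)/=.
rewrite fsum_subset// (le_lt_trans (ler_norm_sum _ _ _))//.
rewrite (le_lt_trans (ler_sum _ (fun i _ => TM i)))//.
rewrite -mulr_suml -rmorph_sum -rmorphM/= eE ltcR -fsum_subset//.
rewrite (@le_lt_trans _ _ (complex.Re e / (M + 1) * M))//.
  rewrite ler_wpM2r// lerBlDr.
  rewrite (le_trans (fsum_weights_le1 B))// -lerBlDl; exact: ltW.
by rewrite mulrAC ltr_pdivrMr// ltr_pM2l// ltrDl.
Qed.

End absolute_summability.

Lemma hdot_bop_cvg (R : realType) (F : hilbertType R) {T : Type}
    (G : set_system T) {FG : Filter G} (f : T -> bop F) (x : bop F) u v :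
  f @ G --> x -> (fun t => '[f t u, v] : R[i]^o) @ G --> ('[x u, v] : R[i]^o).
Proof.
move=> fx; apply: hdot_cvgl; apply/cvgrPdist_lt => eps eps0.
have u1 : 0 < `|u| + 1 by rewrite ltr_wpDl.
near=> t.
have xt : `|x - f t| < eps / (`|u| + 1).
  by near: t; apply: (@cvgr_dist_lt _ _ _ _ _ _ _ fx); rewrite divr_gt0.
rewrite -bopBE (le_lt_trans (bop_normP _ _))//.
rewrite (@le_lt_trans _ _ (`|x - f t| * (`|u| + 1)))//.
  by rewrite ler_wpM2l// lerDl.
by rewrite -ltr_pdivlMr.
Unshelve. all: by end_near.
Qed.

(** * Matrix entries of [P_omega] on elementary tensors *)

Section transition_operator.
Context {R : realType} {H F : hilbertType R} (tens : seq H -> F).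
Hypothesis hF : is_full_fock tens.
Context {Theta : choiceType} (e : Theta -> H) (omega : Theta -> R).
Hypothesis e1 : forall i, '[e i, e i] = 1.
Hypothesis omega_gt0 : forall i, 0 < omega i.
Hypothesis omega_sum : (\esum_(i in [set: Theta]) (omega i)%:E = 1)%E.
Implicit Types (x y w : bop F) (s t : seq H).

Local Notation P := (P_omega tens e omega).
Local Notation entry x s t := '[bop_fun x (tens s), tens t].

Let norm_e i : `|e i| = 1.
Proof. by apply/eqP; rewrite -(@eqrXn2 _ 2)// expr1n hdotE e1. Qed.

Let creation_norm i u : `|creation tens (e i) u| = `|u|.
Proof.
apply/eqP; rewrite -(@eqrXn2 _ 2)// !hdotE; apply/eqP.
exact: (creation_isometry hF).
Qed.

(** With [v] the image of [u] under the adjoint of l_i, |v|^2 = <l_i v, u> <= |l_i v| |u| = |v|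
    |u|. *)
Let adjoint_norm i u : `|adjoint (creation tens (e i)) u| <= `|u|.
Proof.
set v := adjoint _ u.
have [->|v0] := eqVneq v 0; first by rewrite normr0.
rewrite -(@ler_pM2l _ `|v|) ?normr_gt0// -expr2 hdotE.
rewrite -adjoint_creationE// -(creation_norm i v).
have vv0 : 0 <= '[creation tens (e i) v, u].
  by rewrite adjoint_creationE// -hdotE exprn_ge0.
by rewrite -(ger0_norm vv0) hdot_CauchySchwarz.
Qed.

Lemma P_omega_cvg x u v :
  (fun A : {fset Theta} => \sum_(i <- A) (omega i)%:C *
     '[x (creation tens (e i) u), creation tens (e i) v] : R[i]^o) @ totally
    --> ('[P x u, v] : R[i]^o).
Proof.
pose T i := (omega i)%:C *: bop_comp (adjoint (creation tens (e i)))
  (bop_comp x (creation tens (e i))).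
have Tx : partial_sum T @ totally --> P x.
  (* [P x] is by definition the limit of these partial sums, which is meaningful once they are known
     to converge. *)
  suff : cvg (partial_sum T @ totally) by [].
  apply: (weighted_family_cvg omega_sum (opnorm_ge0 x)) => i.
  have omega0 : (0 : R[i]) <= (omega i)%:C by rewrite ler0c ltW.
  rewrite normrZ (ger0_norm omega0); apply: ler_wpM2l => //.
  apply: bop_norm_le => [|w]; first by rewrite ler0c opnorm_ge0.
  rewrite (le_trans (adjoint_norm i _))//= (le_trans (opnormP x _))//.
  by rewrite creation_norm.
suff -> : (fun A : {fset Theta} => \sum_(i <- A) (omega i)%:C *
     '[x (creation tens (e i) u), creation tens (e i) v] : R[i]^o) =
     (fun A => '[partial_sum T A u, v] : R[i]^o) by exact: hdot_bop_cvg.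
apply/funext => A; rewrite /partial_sum -(big_seq_fsetE _ _ predT T)/=.
have -> : (\sum_(i <- A) T i) u = \sum_(i <- A) T i u.
  by elim: (enum_fset A) => [|i r IH]; rewrite ?big_nil// !big_cons -IH.
rewrite hdot_suml; apply: eq_bigr => i _.
have -> : T i u = (omega i)%:C *: adjoint (creation tens (e i))
  (x (creation tens (e i) u)) by [].
by rewrite hdotZl; congr (_ * _); rewrite hdotC [RHS]hdotC adjoint_creationE.
Qed.

(** An entry of [P x] is the weighted average over [i] of the entries of [x] with [e i] prefixed to
    both words, so a factor common to all letters passes through. *)
Lemma P_omega_entry x y a s t s' t' :
    (forall i, entry y (e i :: s) (e i :: t) = a * entry x (e i :: s') (e i :: t')) ->
  entry (P y) s t = a * entry (P x) s' t'.
Proof.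
move=> yx; have /cvg_unique := @P_omega_cvg y (tens s) (tens t); apply => //.
have -> : (fun A : {fset Theta} => \sum_(i <- A) (omega i)%:C *
    '[y (creation tens (e i) (tens s)), creation tens (e i) (tens t)] : R[i]^o) =
  (fun A => a *: (\sum_(i <- A) (omega i)%:C *
    '[x (creation tens (e i) (tens s')), creation tens (e i) (tens t')] : R[i]^o)).
  apply/funext => A; rewrite scaler_sumr; apply: eq_bigr => i _.
  by rewrite !creationE// yx mulrCA.
by apply: cvgZl_tmp; exact: P_omega_cvg.
Qed.

(** An average with total weight 1 of a constant; this is how the right creation and gauge operators
    are recognised as eigenvectors. *)
Lemma P_omega_entry_cst y c s t :
  (forall i, entry y (e i :: s) (e i :: t) = c) -> entry (P y) s t = c.
Proof.
move=> yc; have /cvg_unique := @P_omega_cvg y (tens s) (tens t); apply => //.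
have -> : (fun A : {fset Theta} => \sum_(i <- A) (omega i)%:C *
    '[y (creation tens (e i) (tens s)), creation tens (e i) (tens t)] : R[i]^o) =
  (fun A => (\sum_(i <- A) (omega i)%:C : R[i]^o) *: (c : R[i]^o)).
  apply/funext => A; rewrite scaler_suml; apply: eq_bigr => i _.
  by rewrite !creationE// yc.
have := cvgZr_tmp (a := c : R[i]^o) (weights_cvg1 omega_gt0 omega_sum).
by rewrite scale1r; exact.
Qed.

Lemma P_omegaZ a x : P (a *: x) = a *: P x.
Proof.
apply: (bop_eq_tens hF) => s t; rewrite [RHS]hdotZl.
by apply: P_omega_entry => i; rewrite -hdotZl.
Qed.

Lemma iter_eigenspace lambda x m : peripheral_eigenspace tens e omega lambda x ->
  iter m P x = lambda ^+ m *: x.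
Proof.
move=> Px; elim: m => [|m IH]; first by rewrite scale1r.
by rewrite iterS IH P_omegaZ Px scalerA exprSr.
Qed.

(* [sigma] and [tau] are the identity or append a letter on the right, so that
   they commute with the letters that [P] inserts on the left. *)
Lemma iter_P_omega_entry (sigma tau : seq H -> seq H)
    (a : seq H -> seq H -> R[i]) (b : R[i]) x y :
    (forall i s, sigma (e i :: s) = e i :: sigma s) ->
    (forall i t, tau (e i :: t) = e i :: tau t) ->
    (forall i s t, a (e i :: s) (e i :: t) = b * a s t) ->
    (forall s t, entry y s (tau t) = a s t * entry x (sigma s) t) ->
  forall m s t,
    entry (iter m P y) s (tau t) = b ^+ m * a s t * entry (iter m P x) (sigma s) t.
Proof.
move=> sigma_cons tau_cons a_cons yx; elim=> [|m IH] s t.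
  by rewrite mul1r yx.
rewrite !iterS; apply: P_omega_entry => i.
by rewrite -tau_cons IH a_cons sigma_cons exprSr !mulrA.
Qed.

End transition_operator.

(** * The Choi-Effros product *)

Section choi_effros_entries.
Context {R : realType} {H F : hilbertType R} (tens : seq H -> F).
Hypothesis hF : is_full_fock tens.
Context {Theta : choiceType} (e : Theta -> H) (omega : Theta -> R).
Hypothesis e1 : forall i, '[e i, e i] = 1.
Hypothesis omega_gt0 : forall i, 0 < omega i.
Hypothesis omega_sum : (\esum_(i in [set: Theta]) (omega i)%:E = 1)%E.
Implicit Types (x y w : bop F) (s t : seq H).

Local Notation P := (P_omega tens e omega).
Local Notation entry x s t := '[bop_fun x (tens s), tens t].
Local Notation eigen := (peripheral_eigenspace tens e omega).
Local Notation boundary := (peripheral_boundary tens e omega).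
Local Notation eigenspan :=
  (lspan (\bigcup_(lambda in @unit_circle R) eigen lambda)).

Lemma eigenspan_boundary x : eigenspan x -> boundary x.
Proof. exact: subset_closure. Qed.

Lemma eigen_boundary lambda x : `|lambda| = 1 -> eigen lambda x -> boundary x.
Proof.
move=> l1 xl; apply: eigenspan_boundary; exists [:: (1, x)].
  by move=> p; rewrite inE => /eqP ->; exists lambda.
by rewrite big_seq1 scale1r.
Qed.

(* [mult] is left or right multiplication by an element of [E_mu], and [opw]
   the corresponding Choi-Effros multiplication. *)
Lemma choi_effros_entry (mu : R[i]) (mult opw : bop F -> bop F)
    (sigma tau : seq H -> seq H) (a : seq H -> seq H -> R[i]) :
    `|mu| = 1 ->
    (forall c x x', boundary x -> boundary x' ->
      opw (c *: x + x') = c *: opw x + opw x') ->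
    {within boundary, continuous opw} ->
    (forall lambda x, `|lambda| = 1 -> eigen lambda x -> forall v,
      ((lambda * mu) ^- m *: iter m P (mult x)) v @[m --> \oo] --> opw x v) ->
    (forall i s, sigma (e i :: s) = e i :: sigma s) ->
    (forall i t, tau (e i :: t) = e i :: tau t) ->
    (forall i s t, a (e i :: s) (e i :: t) = mu * a s t) ->
    (forall x s t, entry (mult x) s (tau t) = a s t * entry x (sigma s) t) ->
  forall x, boundary x ->
    forall s t, entry (opw x) s (tau t) = a s t * entry x (sigma s) t.
Proof.
move=> mu1 opw_lin opw_cont opw_lim sigma_cons tau_cons a_cons multE x bx s t.
(* On an eigenvector, the powers of [lambda] and [mu] produced by the iterates cancel the
   normalisation, so the sequence of entries is constant and equals its limit. *)
have opw_eigen lambda y : `|lambda| = 1 -> eigen lambda y ->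
    entry (opw y) s (tau t) = a s t * entry y (sigma s) t.
  move=> l1 yl.
  have := hdot_cvgl (v := tens (tau t)) (opw_lim lambda y l1 yl (tens s)).
  move=> /(_ _)/cvg_unique; apply => //.
  have -> : (fun m : nat => '[((lambda * mu) ^- m *: iter m P (mult y)) (tens s),
      tens (tau t)] : R[i]^o) = (fun=> a s t * entry y (sigma s) t).
    apply/funext => m.
    rewrite [LHS]hdotZl.
    rewrite (iter_P_omega_entry hF e1 omega_gt0 omega_sum sigma_cons tau_cons
      a_cons (multE y)).
    rewrite (iter_eigenspace hF e1 omega_gt0 omega_sum m yl).
    rewrite [X in _ * (_ * X)]hdotZl exprMn.
    have l0 : lambda ^+ m != 0.
      by rewrite expf_neq0// -normr_eq0 l1 oner_neq0.
    have m0 : mu ^+ m != 0 by rewrite expf_neq0// -normr_eq0 mu1 oner_neq0.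
    have cancel (K : fieldType) (l k b c : K) : l != 0 -> k != 0 ->
      (l * k)^-1 * (k * b * (l * c)) = b * c by move=> *; field; apply/andP.
    exact: cancel.
  exact: cvg_cst.
have opw0 : opw 0 = 0.
  have b0 : boundary 0.
    by apply: eigenspan_boundary; exists [::] => //; rewrite big_nil.
  (* Linearity at [c = -1] on zero vectors reads [opw 0 = - opw 0 + opw 0]. *)
  by have := opw_lin (-1) 0 0 b0 b0; rewrite scaler0 addr0 scaleN1r addNr.
have opw_span y : eigenspan y ->
    boundary y /\ entry (opw y) s (tau t) = a s t * entry y (sigma s) t.
  move=> sy; split; first exact: eigenspan_boundary.
  case: sy => r + ->; elim: r => [|[c z] r IH] rE.
    by rewrite big_nil opw0 [LHS]hdot0l [X in _ * X]hdot0l mulr0.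
  have [lambda /= l1 zl] := rE _ (mem_head _ _).
  have rE' p : p \in r -> (\bigcup_(lambda in @unit_circle R) eigen lambda) p.2.
    by move=> pr; apply: rE; rewrite inE pr orbT.
  rewrite big_cons opw_lin; last 2 first.
  - exact: eigen_boundary zl.
  - by apply: eigenspan_boundary; exists r.
  rewrite [LHS]hdotDl [X in _ * X]hdotDl [X in X + _]hdotZl.
  rewrite [X in _ * (X + _)]hdotZl (opw_eigen lambda)// IH//.
  by rewrite mulrDr mulrCA.
(* This filter is proper because [x] is in the closure of the span. Both sides converge along it,
   [opw] being continuous within the boundary, which contains the span. *)
pose G := within eigenspan (nbhs x).
have PG : ProperFilter G.
  apply: Build_ProperFilter_ex => B GB.
  by have [y [sy /(_ sy) By]] := bx _ GB; exists y.
have Gx : id @ G --> x by exact: cvg_within.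
have opwG : opw @ G --> opw x.
  move/subspace_continuousP: opw_cont => /(_ x bx); apply: cvg_trans.
  apply: cvg_app => B bB; apply: (@filterS _ (nbhs x) _ _ _ _ bB) => y By sy.
  exact/By/eigenspan_boundary.
have /(_ _)/cvg_unique := hdot_bop_cvg (u := tens s) (v := tens (tau t)) opwG.
apply => //.
have := hdot_bop_cvg (u := tens (sigma s)) (v := tens t) Gx.
move=> /(_ _)/(cvgZl_tmp (k := a s t)); apply: cvg_trans; apply: near_eq_cvg.
apply: filterS (withinT _ _) => y /opw_span[_ ->] //.
Qed.

(** Freezing the second factor at [w], a point of the boundary, turns the joint continuity of [op]
    into continuity within the boundary in the first. *)
Lemma choi_effros_right op mu w (mult := fun x => bop_comp x w) sigma tau a :
    is_choi_effros tens e omega op -> `|mu| = 1 -> eigen mu w ->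
    (forall i s, sigma (e i :: s) = e i :: sigma s) ->
    (forall i t, tau (e i :: t) = e i :: tau t) ->
    (forall i s t, a (e i :: s) (e i :: t) = mu * a s t) ->
    (forall x s t, entry (mult x) s (tau t) = a s t * entry x (sigma s) t) ->
  forall x, boundary x ->
    forall s t, entry (op x w) s (tau t) = a s t * entry x (sigma s) t.
Proof.
move=> hop mu1 wmu sigma_cons tau_cons a_cons multE.
have bw := eigen_boundary mu1 wmu.
apply: (@choi_effros_entry mu mult (op^~ w)) => //.
- by move=> c x x' bx bx'; rewrite (choi_effros_linearl hop).
- apply/subspace_continuousP => x bx.
  have /subspace_continuousP/(_ (x, w)) := choi_effros_continuous hop.
  move=> /(_ (conj bx bw)).
  apply: (@cvg_comp _ _ _ (fun y => (y, w)) (fun z => op z.1 z.2)) => B xwB.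
  have /(_ _ xwB) : (fun y : bop F => (y, w)) @ nbhs x --> (x, w).
    by apply: (@cvg_pair _ _ _ _ (nbhs x) (nbhs w)); [exact: cvg_id|exact: cvg_cst].
  move=> xB; apply: (@filterS _ (nbhs x) _ _ _ _ xB) => y yB yb.
  exact: yB.
- move=> lambda x l1 xl v; exact: (choi_effros_lim hop).
Qed.

Lemma choi_effros_left op mu w (mult := fun x => bop_comp w x) sigma tau a :
    is_choi_effros tens e omega op -> `|mu| = 1 -> eigen mu w ->
    (forall i s, sigma (e i :: s) = e i :: sigma s) ->
    (forall i t, tau (e i :: t) = e i :: tau t) ->
    (forall i s t, a (e i :: s) (e i :: t) = mu * a s t) ->
    (forall x s t, entry (mult x) s (tau t) = a s t * entry x (sigma s) t) ->
  forall x, boundary x ->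
    forall s t, entry (op w x) s (tau t) = a s t * entry x (sigma s) t.
Proof.
move=> hop mu1 wmu sigma_cons tau_cons a_cons multE.
have bw := eigen_boundary mu1 wmu.
apply: (@choi_effros_entry mu mult (op w)) => //.
- by move=> c x x' bx bx'; rewrite (choi_effros_linearr hop).
- apply/subspace_continuousP => x bx.
  have /subspace_continuousP/(_ (w, x)) := choi_effros_continuous hop.
  move=> /(_ (conj bw bx)).
  apply: (@cvg_comp _ _ _ (fun y => (w, y)) (fun z => op z.1 z.2)) => B xwB.
  have /(_ _ xwB) : (fun y : bop F => (w, y)) @ nbhs x --> (w, x).
    by apply: (@cvg_pair _ _ _ _ (nbhs w) (nbhs x)); [exact: cvg_cst|exact: cvg_id].
  move=> xB; apply: (@filterS _ (nbhs x) _ _ _ _ xB) => y yB yb.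
  exact: yB.
- move=> lambda x l1 xl v; rewrite mulrC; exact: (choi_effros_lim hop).
Qed.

End choi_effros_entries.

(** * Central elements are determined by their vacuum expectation *)

Lemma unit_circle_expr_neq (R : realType) (m n : nat) : m != n ->
  exists2 mu : R[i], `|mu| = 1 & mu ^+ m != mu ^+ n.
Proof.
wlog mn : m n / (m < n)%N.
  move=> IH mn; have := mn; rewrite neq_ltn => /orP[lt|lt]; first exact: IH.
  by have [|mu mu1] := IH n m lt; [rewrite eq_sym|rewrite eq_sym; exists mu].
move=> _; have k0 : (0 < n - m)%N by rewrite subn_gt0.
(* With mu^(n - m) = -1, mu^n is the opposite of the nonzero number mu^m. *)
pose mu : R[i] := (n - m).-root (-1).
have muk : mu ^+ (n - m) = -1 by exact: rootCK.
have mu1 : `|mu| = 1.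
  by apply/eqP; rewrite -(@pexpr_eq1 _ _ (n - m))// -normrX muk normrN1.
exists mu => //; rewrite -(subnKC (ltnW mn)) exprD muk mulrN1 eq_sym eqNr.
by rewrite expf_neq0// -normr_eq0 mu1 oner_neq0.
Qed.

Theorem corollaryA (R : realType) (Theta : choiceType)
    (hTheta : (exists2 n : nat, (1 < n)%N & ([set: Theta] #= `I_n)%card) \/
              ([set: Theta] #= [set: nat])%card)
    (H : hilbertType R) (e : Theta -> H) (he : is_onb e)
    (F : hilbertType R) (tens : seq H -> F) (hF : is_full_fock tens)
    (omega : Theta -> R) (omega_gt0 : forall i, 0 < omega i)
    (omega_sum : (\esum_(i in [set: Theta]) (omega i)%:E = 1)%E)
    (op : bop F -> bop F -> bop F) (hop : is_choi_effros tens e omega op)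
    (x : bop F) (hx : peripheral_boundary tens e omega x) :
  (forall y, peripheral_boundary tens e omega y -> op x y = op y x) ->
  exists c : R[i], x = c *: bop1.
Proof.
move=> x_central.
have e1 i : '[e i, e i] = 1 by case: he => -> _; rewrite eqxx.
(* The two sides are entries of [op x r] and [op r x] for the right creation operator [r] of [eta].
   The target ends in a letter, so the vacuum component, where [op r x] and the composition of [r]
   with [x] may differ, is never tested. *)
have x_shift eta xi s t : '[x (tens (rcons s eta)), tens (rcons t xi)] =
    '[eta, xi] * '[x (tens s), tens t].
  have [r rE] := right_creation_ex hF eta.
  have r1 : peripheral_eigenspace tens e omega 1 r.
    rewrite /peripheral_eigenspace /= scale1r.
    apply: (bop_eq_tens hF) => s' t'.
    apply: (P_omega_entry_cst hF e1 omega_gt0 omega_sum) => i.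
    by rewrite !rE rcons_cons hdot_tens_cons// e1 mul1r.
  have br := eigen_boundary (normr1 _) r1.
  have xr := @choi_effros_right _ _ _ _ hF _ _ _ e1 omega_gt0 omega_sum
    op 1 r (fun s => rcons s eta) id (fun _ _ => 1) hop (normr1 _) r1.
  have rx := @choi_effros_left _ _ _ _ hF _ _ _ e1 omega_gt0 omega_sum
    op 1 r id (fun t => rcons t xi) (fun _ _ => '[eta, xi]) hop (normr1 _) r1.
  rewrite -rx//; last 2 first.
  - by move=> *; rewrite mul1r.
  - by move=> y s' t'; exact: (hdot_right_creation hF rE).
  rewrite -x_central// xr ?mul1r//.
  by move=> y s' t'; rewrite /= rE mul1r.
(* Commuting with a gauge unitary multiplies the entry by mu^(size s) on one side and mu^(size t) on
   the other; [mu] is chosen to separate these powers. *)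
have x_graded s t : size s != size t -> '[x (tens s), tens t] = 0.
  move=> /(unit_circle_expr_neq R)[mu mu1 mu_neq].
  have [U UE] := gauge_ex hF mu1.
  have U1 : peripheral_eigenspace tens e omega mu U.
    apply: (bop_eq_tens hF) => s' t'.
    apply: (P_omega_entry_cst hF e1 omega_gt0 omega_sum) => i.
    rewrite [RHS]hdotZl UE hdotZl hdot_tens_cons// e1 mul1r /=.
    by rewrite UE hdotZl exprS mulrA.
  have bU := eigen_boundary mu1 U1.
  have xU := @choi_effros_right _ _ _ _ hF _ _ _ e1 omega_gt0 omega_sum
    op mu U id id (fun s _ => mu ^+ size s) hop mu1 U1.
  have Ux := @choi_effros_left _ _ _ _ hF _ _ _ e1 omega_gt0 omega_sum
    op mu U id id (fun _ t => mu ^+ size t) hop mu1 U1.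
  (* By contraposition: a nonzero entry could be cancelled, making the two powers of [mu] equal. *)
  apply/eqP; move: mu_neq; apply: contraNT => st.
  apply/eqP/(mulIf st); rewrite -xU//; last 2 first.
  - by move=> i s' t'; rewrite -exprS.
  - move=> y s' t'; rewrite /= UE.
    have -> : y (mu ^+ size s' *: tens s') = mu ^+ size s' *: y (tens s').
      by have := bop_linear y (mu ^+ size s') (tens s') 0; rewrite !addr0 bop_0 addr0.
    by rewrite hdotZl.
  rewrite x_central// Ux// => [i s' t'|y s' t'].
    by rewrite -exprS.
  exact: (hdot_gauge hF UE).
exists '[x (tens [::]), tens [::]].
apply: (bop_eq_tens hF) => s t; rewrite [RHS]hdotZl.
have [st|st] := eqVneq (size s) (size t); last first.
  by rewrite x_graded// (hdot_tens_size hF st) mulr0.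
(* Induction on the last letter: the entries of [x] and the inner products of elementary tensors
   satisfy the same recursion, so they stay proportional with the ratio found at the vacuum. *)
elim/last_ind: s t st => [|s eta IH] t.
  by case: t => // _; rewrite (hdot_vacuum hF) mulr1.
case/lastP: t => [|t xi]; first by rewrite size_rcons.
rewrite !size_rcons => -[st].
by rewrite x_shift IH// (hdot_tens_rcons hF) mulrCA.
Qed.
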